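(* Let $\mathcal{G}$ be an ultragraph that satisfies Condition $(L)$, let $R$ be a commutative ring with a unit, let $S$ be a ring, and let $\pi:L_R(\mathcal{G})\to S$ be a homomorphism such that $\pi(r\,p_A)\neq0$ for each $A\in\mathcal{G}^0$ and each non-zero $r\in R$. Then $\pi$ is injective.
   Context: **Ultragraphs.** An ultragraph $\mathcal{G}=(G^0,\mathcal{G}^1,r,s)$ consists of two countable sets $G^0$ (vertices) and $\mathcal{G}^1$ (edges), a map $s:\mathcal{G}^1\to G^0$ and a map $r:\mathcal{G}^1\to P(G^0)\setminus\{\emptyset\}$, where $P(G^0)$ is the power set. $\mathcal{G}^0$ denotes the smallest subset of $P(G^0)$ that contains $\{v\}$ for all $v\in G^0$, contains $r(e)$ for all $e\in\mathcal{G}^1$, and is closed under finite unions and non-empty finite intersections (so all elements of $\mathcal{G}^0$ are non-empty). **Leavitt path algebra.** $L_R(\mathcal{G})$ is the universal (associative, not necessarily unital) $R$-algebra with generators $\{s_e,s_e^*:e\in\mathcal{G}^1\}\cup\{p_A:A\in\mathcal{G}^0\}$ and relations: (1) $p_\emptyset=0$ (convention for empty intersections), $p_Ap_B=p_{A\cap B}$, $p_{A\cup B}=p_A+p_B-p_{A\cap B}$ for $A,B\in\mathcal{G}^0$; (2) $p_{s(e)}s_e=s_ep_{r(e)}=s_e$ and $p_{r(e)}s_e^*=s_e^*p_{s(e)}=s_e^*$ for $e\in\mathcal{G}^1$; (3) $s_e^*s_f=\delta_{e,f}\,p_{r(e)}$ for $e,f\in\mathcal{G}^1$; (4) $p_v=\sum_{s(e)=v}s_es_e^*$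 whenever $0<|s^{-1}(v)|<\infty$, where $p_v=p_{\{v\}}$. **Condition (L).** A path of positive finite length is a sequence of edges $e_1\dots e_n$, $n\ge1$, with $s(e_{i+1})\in r(e_i)$ for $1\le i\le n-1$. A cycle is such a path with $s(e_1)\in r(e_n)$. An exit for the cycle $e_1\dots e_n$ is an edge $e$ with $s(e)=s(e_i)$ for some $i\in\{1,\dots,n\}$ and $e\neq e_i$. A sink is a vertex $v$ with $s^{-1}(v)=\emptyset$. $\mathcal{G}$ satisfies Condition $(L)$ if for each cycle $e_1\dots e_n$, either the cycle has an exit or $r(e_i)$ contains a sink for some $i$. *)

(* Defs.v *)
From HB Require Import structures.
From mathcomp Require Import all_boot all_algebra.
From mathcomp Require Import generic_quotient.
From mathcomp Require Import mathcomp_extra boolp classical_sets.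

Set Implicit Arguments.
Unset Strict Implicit.
Unset Printing Implicit Defensive.

Import GRing.Theory.
Local Open Scope classical_set_scope.
Local Open Scope ring_scope.
Local Open Scope quotient_scope.

(* Associative rings and algebras that need not have a unit. The product is   *)
(* that of the semigroup structure, written (x * y)%g; it is not assumed to   *)
(* be commutative or cancellative.                                            *)

HB.mixin Record Semigroup_Zmodule_isNURing S
    of Semigroup S & GRing.Zmodule S := {
  numulDl : forall x y z : S, ((x + y)%R * z)%g = ((x * z)%g + (y * z)%g)%R;
  numulDr : forall x y z : S, (x * (y + z)%R)%g = ((x * y)%g + (x * z)%g)%R;
}.

#[short(type="nuRingType")]
HB.structure Definition NURing :=
  {S of Semigroup S & GRing.Zmodule S & Semigroup_Zmodule_isNURing S}.

HB.mixin Record NURing_Lmodule_isNUAlgebra (R : comPzRingType) A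
    of NURing A & GRing.Lmodule R A := {
  nuscaleAl : forall (a : R) (x y : A), a *: (x * y)%g = ((a *: x) * y)%g;
  nuscaleAr : forall (a : R) (x y : A), a *: (x * y)%g = (x * (a *: y))%g;
}.

#[short(type="nuAlgType")]
HB.structure Definition NUAlgebra (R : comPzRingType) :=
  {A of NURing A & GRing.Lmodule R A & NURing_Lmodule_isNUAlgebra R A}.

HB.structure Definition NURMorphism (S T : nuRingType) :=
  {f of @GRing.isNmodMorphism S T f & @isMultiplicative S T f}.

Notation "{ 'nurmorphism' S -> T }" := (NURMorphism.type S T)
  (at level 0, S at level 98, T at level 99,
   format "{ 'nurmorphism'  S  ->  T }") : type_scope.

(* The non-unital associative R-algebra presented by generators X and         *)
(* relations rel: algebraic expressions in X modulo the smallest congruence   *)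
(* that contains rel and makes the axioms of an R-algebra hold.               *)

Section Terms.
Variables (R : comPzRingType) (X : Type).

Inductive nuterm : Type :=
| TGen of X
| TZero
| TAdd of nuterm & nuterm
| TOpp of nuterm
| TScale of R & nuterm
| TMul of nuterm & nuterm.

HB.instance Definition _ := gen_eqMixin nuterm.
HB.instance Definition _ := gen_choiceMixin nuterm.

Variable rel : nuterm -> nuterm -> Prop.

Inductive nucong : nuterm -> nuterm -> Prop :=
| nucong_rel x y : rel x y -> nucong x y
| nucong_refl x : nucong x x
| nucong_sym x y : nucong x y -> nucong y x
| nucong_trans y x z : nucong x y -> nucong y z -> nucong x z
| nucong_add x x' y y' :
    nucong x x' -> nucong y y' -> nucong (TAdd x y) (TAdd x' y')
| nucong_opp x x' : nucong x x' -> nucong (TOpp x) (TOpp x')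
| nucong_scale a x x' : nucong x x' -> nucong (TScale a x) (TScale a x')
| nucong_mul x x' y y' :
    nucong x x' -> nucong y y' -> nucong (TMul x y) (TMul x' y')
| nucong_addA x y z : nucong (TAdd x (TAdd y z)) (TAdd (TAdd x y) z)
| nucong_addC x y : nucong (TAdd x y) (TAdd y x)
| nucong_add0 x : nucong (TAdd TZero x) x
| nucong_addN x : nucong (TAdd (TOpp x) x) TZero
| nucong_scaleA a b x : nucong (TScale a (TScale b x)) (TScale (a * b) x)
| nucong_scale1 x : nucong (TScale 1 x) x
| nucong_scaleDr a x y :
    nucong (TScale a (TAdd x y)) (TAdd (TScale a x) (TScale a y))
| nucong_scaleDl x a b :
    nucong (TScale (a + b) x) (TAdd (TScale a x) (TScale b x))
| nucong_mulA x y z : nucong (TMul x (TMul y z)) (TMul (TMul x y) z)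
| nucong_mulDl x y z :
    nucong (TMul (TAdd x y) z) (TAdd (TMul x z) (TMul y z))
| nucong_mulDr x y z :
    nucong (TMul x (TAdd y z)) (TAdd (TMul x y) (TMul x z))
| nucong_scaleAl a x y : nucong (TScale a (TMul x y)) (TMul (TScale a x) y)
| nucong_scaleAr a x y : nucong (TScale a (TMul x y)) (TMul x (TScale a y)).

Definition nucongb (x y : nuterm) : bool := `[< nucong x y >].

Lemma nucongb_refl : reflexive nucongb.
Proof. by move=> x; apply/asboolP/nucong_refl. Qed.

Lemma nucongb_sym : symmetric nucongb.
Proof. by move=> x y; apply/asboolP/asboolP; apply: nucong_sym. Qed.

Lemma nucongb_trans : transitive nucongb.
Proof.
move=> y x z /asboolP xy /asboolP yz; apply/asboolP.
exact: nucong_trans xy yz.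
Qed.

Canonical nucong_equiv :=
  EquivRel nucongb nucongb_refl nucongb_sym nucongb_trans.

Definition presalg : Type := {eq_quot nucongb}.

HB.instance Definition _ := Choice.on presalg.
HB.instance Definition _ := EqQuotient.on presalg.

Definition presalg_class (x : nuterm) : presalg := \pi_presalg x.

Lemma presalg_classP x y : presalg_class x = presalg_class y <-> nucong x y.
Proof.
split=> [/eqmodP/asboolP //|xy].
by apply/eqmodP/asboolP.
Qed.

Lemma presalg_classW (P : presalg -> Prop) :
  (forall x, P (presalg_class x)) -> forall u, P u.
Proof. by move=> Px u; rewrite -[u]reprK; apply: Px. Qed.

Definition presalg_zero : presalg := presalg_class TZero.
Definition presalg_add (u v : presalg) : presalg :=
  presalg_class (TAdd (repr u) (repr v)).
Definition presalg_opp (u : presalg) : presalg := presalg_class (TOpp (repr u)).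
Definition presalg_scale (a : R) (u : presalg) : presalg :=
  presalg_class (TScale a (repr u)).
Definition presalg_mul (u v : presalg) : presalg :=
  presalg_class (TMul (repr u) (repr v)).

Lemma repr_class x : nucong (repr (presalg_class x)) x.
Proof. by apply/presalg_classP; rewrite /presalg_class reprK. Qed.

Lemma presalg_addE x y :
  presalg_add (presalg_class x) (presalg_class y) = presalg_class (TAdd x y).
Proof. by apply/presalg_classP/nucong_add; apply: repr_class. Qed.

Lemma presalg_oppE x : presalg_opp (presalg_class x) = presalg_class (TOpp x).
Proof. by apply/presalg_classP/nucong_opp; apply: repr_class. Qed.

Lemma presalg_scaleE a x :
  presalg_scale a (presalg_class x) = presalg_class (TScale a x).
Proof. by apply/presalg_classP/nucong_scale; apply: repr_class. Qed.

Lemma presalg_mulE x y :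
  presalg_mul (presalg_class x) (presalg_class y) = presalg_class (TMul x y).
Proof. by apply/presalg_classP/nucong_mul; apply: repr_class. Qed.

Let E := (presalg_addE, presalg_oppE, presalg_scaleE, presalg_mulE).

Fact presalg_addA : associative presalg_add.
Proof.
do 3![elim/presalg_classW=> ?]; rewrite !E; apply/presalg_classP.
exact: nucong_addA.
Qed.

Fact presalg_addC : commutative presalg_add.
Proof.
do 2![elim/presalg_classW=> ?]; rewrite !E; apply/presalg_classP.
exact: nucong_addC.
Qed.

Fact presalg_add0 : left_id presalg_zero presalg_add.
Proof. by elim/presalg_classW=> ?; rewrite !E; apply/presalg_classP/nucong_add0. Qed.

Fact presalg_addN : left_inverse presalg_zero presalg_opp presalg_add.
Proof. by elim/presalg_classW=> ?; rewrite !E; apply/presalg_classP/nucong_addN. Qed.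

HB.instance Definition _ := GRing.isZmodule.Build presalg
  presalg_addA presalg_addC presalg_add0 presalg_addN.

Fact presalg_scaleA a b u :
  presalg_scale a (presalg_scale b u) = presalg_scale (a * b) u.
Proof.
by elim/presalg_classW: u => ?; rewrite !E; apply/presalg_classP/nucong_scaleA.
Qed.

Fact presalg_scale1 : left_id 1 presalg_scale.
Proof.
by elim/presalg_classW=> ?; rewrite !E; apply/presalg_classP/nucong_scale1.
Qed.

Fact presalg_scaleDr : right_distributive presalg_scale +%R.
Proof.
move=> a; do 2![elim/presalg_classW=> ?].
by rewrite /GRing.add /= !E; apply/presalg_classP/nucong_scaleDr.
Qed.

Fact presalg_scaleDl u : {morph presalg_scale^~ u : a b / a + b}.
Proof.
move=> a b; elim/presalg_classW: u => ?.
by rewrite [RHS]/GRing.add /= !E; apply/presalg_classP/nucong_scaleDl.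
Qed.

HB.instance Definition _ := GRing.Zmodule_isLmodule.Build R presalg
  presalg_scaleA presalg_scale1 presalg_scaleDr presalg_scaleDl.

HB.instance Definition _ := hasMul.Build presalg presalg_mul.

Fact presalg_mulA : associative presalg_mul.
Proof.
do 3![elim/presalg_classW=> ?]; rewrite !E; apply/presalg_classP.
exact: nucong_mulA.
Qed.

HB.instance Definition _ := Magma_isSemigroup.Build presalg presalg_mulA.

Lemma presalg_classD x y :
  presalg_class (TAdd x y) = presalg_class x + presalg_class y.
Proof. exact/esym/presalg_addE. Qed.

Lemma presalg_classN x : presalg_class (TOpp x) = - presalg_class x.
Proof. exact/esym/presalg_oppE. Qed.

Lemma presalg_classZ a x : presalg_class (TScale a x) = a *: presalg_class x.
Proof. exact/esym/presalg_scaleE. Qed.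

Lemma presalg_classM x y :
  presalg_class (TMul x y) = (presalg_class x * presalg_class y)%g.
Proof. exact/esym/presalg_mulE. Qed.

Fact presalg_mulDl (x y z : presalg) :
  ((x + y)%R * z)%g = ((x * z)%g + (y * z)%g)%R.
Proof.
elim/presalg_classW: x => x; elim/presalg_classW: y => y.
elim/presalg_classW: z => z; rewrite -!(presalg_classM, presalg_classD).
exact/presalg_classP/nucong_mulDl.
Qed.

Fact presalg_mulDr (x y z : presalg) :
  (x * (y + z)%R)%g = ((x * y)%g + (x * z)%g)%R.
Proof.
elim/presalg_classW: x => x; elim/presalg_classW: y => y.
elim/presalg_classW: z => z; rewrite -!(presalg_classM, presalg_classD).
exact/presalg_classP/nucong_mulDr.
Qed.

HB.instance Definition _ := Semigroup_Zmodule_isNURing.Build presalg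
  presalg_mulDl presalg_mulDr.

Fact presalg_scaleAl a (x y : presalg) : a *: (x * y)%g = ((a *: x) * y)%g.
Proof.
elim/presalg_classW: x => x; elim/presalg_classW: y => y.
rewrite -presalg_classM -!presalg_classZ -presalg_classM.
exact/presalg_classP/nucong_scaleAl.
Qed.

Fact presalg_scaleAr a (x y : presalg) : a *: (x * y)%g = (x * (a *: y))%g.
Proof.
elim/presalg_classW: x => x; elim/presalg_classW: y => y.
rewrite -presalg_classM -!presalg_classZ -presalg_classM.
exact/presalg_classP/nucong_scaleAr.
Qed.

HB.instance Definition _ := NURing_Lmodule_isNUAlgebra.Build R presalg
  presalg_scaleAl presalg_scaleAr.

Fixpoint nueval (B : nuAlgType R) (f : X -> B) (t : nuterm) : B :=
  match t with
  | TGen x => f x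
  | TZero => 0
  | TAdd x y => nueval f x + nueval f y
  | TOpp x => - nueval f x
  | TScale a x => a *: nueval f x
  | TMul x y => (nueval f x * nueval f y)%g
  end.

Lemma presalg_class_eval x :
  presalg_class x = nueval (fun g => presalg_class (TGen g)) x.
Proof.
by elim: x => //= [x <- y <-|x <-|a x <-|x <- y <-]; 
  rewrite (presalg_classD, presalg_classN, presalg_classZ, presalg_classM).
Qed.

Lemma nueval_cong (B : nuAlgType R) (f : X -> B) :
    (forall x y, rel x y -> nueval f x = nueval f y) ->
  forall x y, nucong x y -> nueval f x = nueval f y.
Proof.
move=> frel x y; elim=> //= {x y}; do ?congruence.
- by move=> x y z; rewrite addrA.
- by move=> x y; rewrite addrC.
- by move=> x; rewrite add0r.
- by move=> x; rewrite addNr.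
- by move=> a b x; rewrite scalerA.
- by move=> x; rewrite scale1r.
- by move=> a x y; rewrite scalerDr.
- by move=> x a b; rewrite scalerDl.
- by move=> x y z; rewrite mulgA.
- by move=> x y z; rewrite numulDl.
- by move=> x y z; rewrite numulDr.
- by move=> a x y; rewrite nuscaleAl.
- by move=> a x y; rewrite nuscaleAr.
Qed.

Lemma presalg_universal (B : nuAlgType R) (f : X -> B) :
    (forall x y, rel x y -> nueval f x = nueval f y) ->
  exists! F : presalg -> B,
    [/\ forall u v, F (u + v) = F u + F v,
        forall a u, F (a *: u) = a *: F u,
        forall u v, F (u * v)%g = (F u * F v)%g
      & forall x, F (presalg_class (TGen x)) = f x].
Proof.
move=> frel.
have evE t : nueval f (repr (presalg_class t)) = nueval f t.
  exact/(nueval_cong frel)/repr_class.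
exists (fun u => nueval f (repr u)); split.
  by split=> [u v|a u|u v|x]; rewrite evE.
move=> F [FD FZ FM Fg]; apply/funext; elim/presalg_classW=> t; rewrite evE.
have F0 : F 0 = 0 by rewrite -(scale0r 0) FZ scale0r.
have FN u : F (- u) = - F u by rewrite -!scaleN1r FZ.
rewrite presalg_class_eval.
by elim: t => //= [x IHx y IHy|x IHx|a x IHx|x IHx y IHy];
  rewrite ?(FD, FN, FZ, FM) ?IHx ?IHy.
Qed.

End Terms.

Arguments TGen {R X}.
Arguments TZero {R X}.
Arguments TAdd {R X}.
Arguments TOpp {R X}.
Arguments TMul {R X}.

Record ultragraph : Type := Ultragraph {
  vertex : countType;
  edge : countType;
  src : edge -> vertex;
  rng : edge -> set vertex;
  rng_neq0 : forall e, rng e !=set0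
}.

Arguments src {u}.
Arguments rng {u}.

Section Ultragraph.
Variable G : ultragraph.

Inductive gset : set (vertex G) -> Prop :=
| gset1 v : gset [set v]
| gset_rng e : gset (rng e)
| gsetU A B : gset A -> gset B -> gset (A `|` B)
| gsetI A B : gset A -> gset B -> A `&` B !=set0 -> gset (A `&` B).

Definition sink (v : vertex G) : Prop := forall e : edge G, src e <> v.

(* path.cycle closes the path: it also asks that src e_1 \in rng e_n. *)
Definition ultracycle (c : seq (edge G)) : Prop :=
  c <> [::] /\ cycle (fun e f => src f \in rng e) c.

Definition cycle_exit (c : seq (edge G)) (e : edge G) : Prop :=
  exists2 f, f \in c & src e = src f /\ e <> f.

Definition condition_L : Prop :=
  forall c : seq (edge G), ultracycle c ->
    (exists e, cycle_exit c e) \/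
    (exists2 e, e \in c & exists2 v, rng e v & sink v).

Variable R : comPzRingType.

Inductive lpa_gen : Type :=
| GenP A of gset A
| GenS of edge G
| GenSstar of edge G.

Local Notation term := (nuterm R lpa_gen).

(* 0 outside gset, in particular for the empty set. *)
Definition termP (A : set (vertex G)) : term :=
  if pselect (gset A) is left hA then TGen (GenP hA) else TZero.
Definition termS (e : edge G) : term := TGen (GenS e).
Definition termSstar (e : edge G) : term := TGen (GenSstar e).

(* In lpa_CK, es enumerates the edges with source v; such a list exists       *)
(* exactly when there are finitely many of them, and it is non-empty exactly  *)
(* when there is at least one.                                                *)
Inductive lpa_rel : term -> term -> Prop :=
| lpa_PI A B : gset A -> gset B ->
    lpa_rel (TMul (termP A) (termP B)) (termP (A `&` B))
| lpa_PU A B : gset A -> gset B ->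
    lpa_rel (termP (A `|` B))
            (TAdd (TAdd (termP A) (termP B)) (TOpp (termP (A `&` B))))
| lpa_srcS e : lpa_rel (TMul (termP [set src e]) (termS e)) (termS e)
| lpa_Srng e : lpa_rel (TMul (termS e) (termP (rng e))) (termS e)
| lpa_rngSstar e :
    lpa_rel (TMul (termP (rng e)) (termSstar e)) (termSstar e)
| lpa_Sstarsrc e :
    lpa_rel (TMul (termSstar e) (termP [set src e])) (termSstar e)
| lpa_SstarS e f :
    lpa_rel (TMul (termSstar e) (termS f))
            (if e == f then termP (rng e) else TZero)
| lpa_CK v (es : seq (edge G)) :
    es <> [::] -> uniq es -> (forall e, e \in es <-> src e = v) ->
    lpa_rel (termP [set v])
            (\big[TAdd/TZero]_(e <- es) TMul (termS e) (termSstar e)).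

Definition leavitt : Type := presalg lpa_rel.

HB.instance Definition _ := NUAlgebra.on leavitt.

Definition lpaP (A : set (vertex G)) : leavitt :=
  presalg_class lpa_rel (termP A).
Definition lpaS (e : edge G) : leavitt := presalg_class lpa_rel (termS e).
Definition lpaSstar (e : edge G) : leavitt :=
  presalg_class lpa_rel (termSstar e).

Lemma gset_neq0 A : gset A -> A !=set0.
Proof.
elim=> {A} [v|e|A B _ [x Ax] _ _|A B _ _ _ _ //]; first by exists v.
- exact: rng_neq0.
- by exists x; left.
Qed.

Lemma lpaP0 : lpaP set0 = 0.
Proof.
by rewrite /lpaP /termP; case: pselect => // h; case: (gset_neq0 h).
Qed.

Let lpa_relE x y : lpa_rel x y ->
  presalg_class lpa_rel x = presalg_class lpa_rel y.
Proof. by move=> xy; apply/presalg_classP; apply: nucong_rel. Qed.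

Lemma lpaP_setI A B : gset A -> gset B ->
  (lpaP A * lpaP B)%g = lpaP (A `&` B).
Proof. by move=> hA hB; rewrite -presalg_classM (lpa_relE (lpa_PI hA hB)). Qed.

Lemma lpaP_setU A B : gset A -> gset B ->
  lpaP (A `|` B) = lpaP A + lpaP B - lpaP (A `&` B).
Proof.
move=> hA hB; rewrite /lpaP (lpa_relE (lpa_PU hA hB)).
by rewrite !presalg_classD presalg_classN.
Qed.

Lemma lpaP_S e : (lpaP [set src e] * lpaS e)%g = lpaS e.
Proof. by rewrite -presalg_classM (lpa_relE (lpa_srcS e)). Qed.

Lemma lpaS_P e : (lpaS e * lpaP (rng e))%g = lpaS e.
Proof. by rewrite -presalg_classM (lpa_relE (lpa_Srng e)). Qed.

Lemma lpaP_Sstar e : (lpaP (rng e) * lpaSstar e)%g = lpaSstar e.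
Proof. by rewrite -presalg_classM (lpa_relE (lpa_rngSstar e)). Qed.

Lemma lpaSstar_P e : (lpaSstar e * lpaP [set src e])%g = lpaSstar e.
Proof. by rewrite -presalg_classM (lpa_relE (lpa_Sstarsrc e)). Qed.

Lemma lpaSstar_S e f :
  (lpaSstar e * lpaS f)%g = if e == f then lpaP (rng e) else 0.
Proof.
by rewrite -presalg_classM (lpa_relE (lpa_SstarS e f)); case: ifP.
Qed.

Lemma lpa_CuntzKrieger v (es : seq (edge G)) :
    es <> [::] -> uniq es -> (forall e, e \in es <-> src e = v) ->
  lpaP [set v] = \sum_(e <- es) (lpaS e * lpaSstar e)%g.
Proof.
move=> es0 Ues esP; rewrite /lpaP (lpa_relE (lpa_CK es0 Ues esP)).
elim: es {es0 Ues esP} => [|e es IHes]; first by rewrite !big_nil.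
by rewrite !big_cons presalg_classD presalg_classM IHes.
Qed.

End Ultragraph.

Arguments leavitt : clear implicits.
Arguments lpaP {G} R A.
Arguments lpaS {G} R e.
Arguments lpaSstar {G} R e.

(* Main.v *)
Require Import Defs.
From mathcomp Require Import all_boot all_algebra.
From mathcomp Require Import mathcomp_extra boolp classical_sets.

(** Let [J] be the kernel of [phi]: it is closed under multiplication by
    arbitrary elements on both sides and contains no [r p_A] with [r] nonzero.
    Everything is proved for such a [J], and the claim is that [J] contains
    only [0]. Nonvanishing in the algebra is never checked in a concrete model;
    it is always deduced from the fact that [J] avoids the [r p_A].

    Under Condition (L), an element [r p_v + \sum r_i p_v s_{g_i} p_v] of [J],
    with nonempty [g_i], has [r = 0] ([loop_sum_coef_eq0]). Compressing it to
    [p_w s_e^* ( - ) s_e p_w], for an edge [e] from [v] and [w] in its range,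
    keeps [r], rotates the [g_i] that begin with [e] and kills the others; the
    exit or the sink provided by Condition (L) is what makes at least one term
    disappear. Hence the paths that end at a fixed vertex are linearly
    independent modulo [J] ([path_coef_eq0]).

    The algebra is spanned by the [s_al p_A s_be^*], and the lemma
    [ghost_span_ideal_eq0] proves [x = 0], for [x] in [J], by induction on a
    bound for the length of the ghost paths [be]. Write [x = y + u] with [y]
    ghost-free and [u] a sum of terms that end in [s_e^*] for some [e] in a
    finite set [E]. For [e] in [E] the element [x s_e] is in [J] and has shorter
    ghost paths, so it is [0]. Therefore [x = y (1 - \sum_(e <- E) s_e s_e^* )].
    Write [y = \sum r_i s_{al_i} p_{A_i}]. Independence of paths shows that for
    each [al] the simple function [\sum r_i 1_{A_i}], over the terms with
    [al_i = al], vanishes at every vertex [v] except those finitely many for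
    which [p_v (1 - \sum_(e <- E) s_e s_e^* )] is [0] by the Cuntz--Krieger
    relation.

    Since the sets [A_i] may be infinite, [p_{A_i}] is not a sum of the [p_v],
    and passing from vertices back to sets needs an argument: a function on a
    lattice of sets with [F (A `|` B) = F A + F B - F (A `&` B)] extends to
    combinations of indicator functions ([modular_sum_eq0]). It is applied to
    [F A = s_al p_A (1 - \sum_(e <- E) s_e s_e^* )]. *)

Set Implicit Arguments.
Unset Strict Implicit.
Unset Printing Implicit Defensive.

Import GRing.Theory.
Local Open Scope ring_scope.

(** * Arithmetic in a non-unital ring *)

Section NURingTheory.
Variable S : nuRingType.
Implicit Types x y z : S.

Lemma numul0r x : (0%R * x)%g = 0 :> S.
Proof. by apply: (addrI (0%R * x)%g); rewrite -numulDl !addr0. Qed.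

Lemma numulr0 x : (x * 0%R)%g = 0 :> S.
Proof. by apply: (addrI (x * 0%R)%g); rewrite -numulDr !addr0. Qed.

Lemma numulNr x y : ((- x)%R * y)%g = - (x * y)%g.
Proof. by apply: (addrI (x * y)%g); rewrite -numulDl !subrr numul0r. Qed.

Lemma numulBl x y z : ((x - y)%R * z)%g = (x * z)%g - (y * z)%g.
Proof. by rewrite numulDl numulNr. Qed.

Lemma numul_suml I (r : seq I) (P : pred I) (F : I -> S) x :
  ((\sum_(i <- r | P i) F i)%R * x)%g = \sum_(i <- r | P i) (F i * x)%g.
Proof.
apply: (big_morph (fun y => (y * x)%g)) => [y z|]; first exact: numulDl.
exact: numul0r.
Qed.

Lemma numul_sumr I (r : seq I) (P : pred I) (F : I -> S) x :
  (x * (\sum_(i <- r | P i) F i)%R)%g = \sum_(i <- r | P i) (x * F i)%g.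
Proof.
apply: (big_morph (fun y => (x * y)%g)) => [y z|]; first exact: numulDr.
exact: numulr0.
Qed.

End NURingTheory.

(** * Modular functions on a lattice of sets *)

Section ModularSetFunction.
Local Open Scope classical_set_scope.
Variables (R : pzRingType) (M : lmodType R) (T : eqType).
Variable lat : set T -> Prop.
Hypothesis lat0 : lat set0.
Hypothesis latU : forall A B, lat A -> lat B -> lat (A `|` B).
Hypothesis latI : forall A B, lat A -> lat B -> lat (A `&` B).
Variable F : set T -> M.
Hypothesis F0 : F set0 = 0.
Hypothesis FU : forall A B, lat A -> lat B ->
  F (A `|` B) = F A + F B - F (A `&` B).

(** Adding one null point [v] at a time: the modular law gives
    [F (A `|` [set v]) = F A + F [set v] - F (A `&` [set v])], and the last
    intersection is [set v] or empty, so both corrections vanish. *)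
Lemma modular_null_setU A (N : seq T) : lat A ->
    (forall v, v \in N -> lat [set v] /\ F [set v] = 0) ->
  lat (A `|` [set` N]) /\ F (A `|` [set` N]) = F A.
Proof.
move=> latA; elim: N => [|v N IHN] nullN; first by rewrite set_nil setU0.
have [|latN FN] := IHN; first by move=> w wN; apply: nullN; rewrite inE wN orbT.
have [latv Fv] := nullN v (mem_head _ _).
have -> : [set` v :: N] = [set v] `|` [set` N].
  by apply/seteqP; split=> w /=; rewrite inE => /predU1P.
rewrite setUCA; split; first exact: latU.
rewrite FU // Fv add0r FN -[RHS]subr0; congr (_ - _).
have [Nv|Nv] := pselect ((A `|` [set` N]) v).
  by rewrite (_ : _ `&` _ = [set v]) //; apply/setIidl => _ ->.
by rewrite (_ : _ `&` _ = set0) // -subset0 => w [-> /Nv].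
Qed.

(** The value of [F] on the difference set [A `\` C], which need not belong
    to the lattice. *)
Let dF A C := F A - F (A `&` C).

Let dF_split A B C : lat A -> lat B -> lat C ->
  dF A C = dF (A `&` B) C + dF A (C `|` B).
Proof.
move=> latA latB latC; rewrite /dF setIUr FU; try exact: latI.
rewrite -setIIr (setIC C) setIA -(addrA (F (A `&` C))).
by rewrite [RHS]addrC opprD -[RHS]addrA addrNK.
Qed.

(** The cell [B `\` C] carries the constant [k] of the sets already treated.
    Each further set [A] cuts it into [B `&` A `\` C], where the constant
    becomes [k + r], and [B `\` (C `|` A)], where it stays [k]. When no set is
    left, either the cell has a point outside [N], which forces [k = 0], or
    the cell consists of finitely many null points, which forces
    [dF B C = 0]. *)
Let sum_dF_cell (s : seq (R * set T)) (N : seq T) (k : R) (B C : set T) :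
    lat B -> lat C -> (forall i, i \in s -> lat i.2) ->
    (forall v, v \in N -> lat [set v] /\ F [set v] = 0) ->
    (forall v, B v -> ~ C v -> v \notin N ->
       k + \sum_(i <- s) i.1 *+ (v \in i.2) = 0) ->
  k *: dF B C + \sum_(i <- s) i.1 *: dF (B `&` i.2) C = 0.
Proof.
elim: s => [|[r A] s IHs] in k B C * => latB latC lats nullN sum0.
  rewrite big_nil addr0.
  have [[v [Bv Cv Nv]]|sub] :=
    pselect (exists v, [/\ B v, ~ C v & v \notin N]).
    by have := sum0 v Bv Cv Nv; rewrite big_nil addr0 => ->; rewrite scale0r.
  have {}sub v : B v -> C v \/ v \in N.
    case: (boolP (v \in N)) => [|Nv Bv]; [by right|left].
    by apply: contrapT => Cv; apply: sub; exists v.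
  pose N' := [seq v <- N | `[< B v >]].
  have [||_ FBC] := @modular_null_setU (B `&` C) N'; first exact: latI.
    by move=> v; rewrite mem_filter => /andP[_]; apply: nullN.
  rewrite /dF -FBC (_ : B `&` C `|` [set` N'] = B) ?subrr ?scaler0 //.
  apply/seteqP; split=> v /=; rewrite mem_filter.
    by case=> [[]|/andP[/asboolP]].
  by move=> /[dup] Bv /sub[|->]; [left|right; rewrite andbT; apply/asboolP].
have latA : lat A by apply: (lats (r, A)); rewrite mem_head.
have {}lats i : i \in s -> lat i.2.
  by move=> si; apply: lats; rewrite inE si orbT.
have IH1 : (k + r) *: dF (B `&` A) C +
    \sum_(i <- s) i.1 *: dF (B `&` A `&` i.2) C = 0.
  apply: IHs => //; first exact: latI.
  move=> v [Bv Av] Cv Nv; have := sum0 v Bv Cv Nv.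
  by rewrite big_cons /= mem_set // addrA.
have IH2 : k *: dF B (C `|` A) +
    \sum_(i <- s) i.1 *: dF (B `&` i.2) (C `|` A) = 0.
  apply: IHs => //; first exact: latU.
  move=> v Bv /not_orP[Cv Av] Nv; have := sum0 v Bv Cv Nv.
  by rewrite big_cons /= memNset // add0r.
rewrite big_cons /= (dF_split latB latA latC) scalerDr.
have -> : \sum_(i <- s) i.1 *: dF (B `&` i.2) C =
    \sum_(i <- s) i.1 *: dF (B `&` A `&` i.2) C +
    \sum_(i <- s) i.1 *: dF (B `&` i.2) (C `|` A).
  rewrite -big_split; apply: eq_big_seq => i /lats lati /=.
  by rewrite (dF_split (latI latB lati) latA latC) setIAC scalerDr.
by rewrite (addrA (r *: _)) addrACA IH2 addr0 addrA -scalerDl.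
Qed.

(** A combination of values of [F] depends only on the same combination of
    indicator functions, and the finitely many null points may be ignored:
    apply the cell lemma to one lattice element [B] containing all the sets,
    with nothing removed and constant [0]. *)
Lemma modular_sum_eq0 (s : seq (R * set T)) (N : seq T) :
    (forall i, i \in s -> lat i.2) ->
    (forall v, v \in N -> lat [set v] /\ F [set v] = 0) ->
    (forall v, v \notin N -> \sum_(i <- s) i.1 *+ (v \in i.2) = 0) ->
  \sum_(i <- s) i.1 *: F i.2 = 0.
Proof.
move=> lats nullN sum0.
have [B latB sB] : exists2 B, lat B & forall i, i \in s -> i.2 `<=` B.
  elim: s lats {sum0} => [|i s IHs] lats; first by exists set0.
  have [|B latB sB] := IHs.
    by move=> j sj; apply: lats; rewrite inE sj orbT.
  exists (i.2 `|` B); first by apply: latU => //; apply: lats; rewrite mem_head.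
  by move=> j; rewrite inE => /predU1P[->|/sB jB] v; [left|right; apply: jB].
transitivity (\sum_(i <- s) i.1 *: dF (B `&` i.2) set0).
  apply: eq_big_seq => i si; rewrite /dF setI0 F0 subr0.
  by rewrite (setIidr (sB i si)).
have := @sum_dF_cell s N 0 B set0 latB lat0 lats nullN.
by rewrite scale0r add0r; apply=> v _ _ /sum0; rewrite add0r.
Qed.

End ModularSetFunction.

(** * Path elements of the Leavitt path algebra *)

Section PathElements.
Local Open Scope classical_set_scope.
Variables (G : ultragraph) (R : comPzRingType).
Local Notation L := (leavitt G R).
Implicit Types (e f g : edge G) (v w : vertex G) (A B : set (vertex G)).
Implicit Types (al be ga : seq (edge G)) (x y : L).

(** Allowing the empty set makes the relations between the [p_A] unconditional,
    since [lpaP R set0 = 0]. *)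
Definition gset0 A : Prop := A = set0 \/ gset A.

Lemma gset0U A B : gset0 A -> gset0 B -> gset0 (A `|` B).
Proof.
move=> [->|gA] [->|gB]; rewrite ?setU0 ?set0U; [by left|by right..|].
by right; apply: gsetU.
Qed.

Lemma gset0I A B : gset0 A -> gset0 B -> gset0 (A `&` B).
Proof.
move=> [->|gA] [->|gB]; rewrite ?setI0 ?set0I; [by left..|].
have [/set0P AB0|/negbNE/eqP ->] := boolP (A `&` B != set0); [right|by left].
exact: gsetI.
Qed.

Lemma gset0_rng e : gset0 (rng e). Proof. right; exact: gset_rng. Qed.
Lemma gset0_set1 v : gset0 [set v]. Proof. right; exact: gset1. Qed.
#[local] Hint Resolve gset0_rng gset0_set1 : core.

Lemma lpaP_mulP A B : gset0 A -> gset0 B ->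
  (lpaP R A * lpaP R B)%g = lpaP R (A `&` B).
Proof.
move=> [->|gA] [->|gB]; rewrite ?setI0 ?set0I ?lpaP0 ?numul0r ?numulr0 //.
exact: lpaP_setI.
Qed.

Lemma lpaP_modular A B : gset0 A -> gset0 B ->
  lpaP R (A `|` B) = lpaP R A + lpaP R B - lpaP R (A `&` B).
Proof.
move=> [->|gA] [->|gB];
  rewrite ?setI0 ?set0I ?setU0 ?set0U ?lpaP0 ?subr0 ?addr0 ?add0r //.
exact: lpaP_setU.
Qed.

Lemma lpaP_mul_set1 A v : gset0 A ->
  (lpaP R A * lpaP R [set v])%g = lpaP R [set v] *+ (v \in A).
Proof.
move=> gA; rewrite lpaP_mulP //; have [Av|nAv] := boolP (v \in A).
  by rewrite (setIidr _) //  => _ ->; apply/set_mem.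
rewrite (_ : _ `&` _ = set0) ?lpaP0 // -subset0 => w [Aw /= wv].
by move: nAv; rewrite -wv mem_set.
Qed.

Lemma lpaP_mulC A B : gset0 A -> gset0 B ->
  (lpaP R A * lpaP R B)%g = (lpaP R B * lpaP R A)%g.
Proof. by move=> gA gB; rewrite !lpaP_mulP // setIC. Qed.

Lemma lpaP_mulS A e : gset0 A ->
  (lpaP R A * lpaS R e)%g = lpaS R e *+ (src e \in A).
Proof.
move=> gA; rewrite -lpaP_S mulgA lpaP_mul_set1 //.
by case: (_ \in _); rewrite ?numul0r.
Qed.

Lemma lpaSstar_mulP A e : gset0 A ->
  (lpaSstar R e * lpaP R A)%g = lpaSstar R e *+ (src e \in A).
Proof.
move=> gA; rewrite -lpaSstar_P -mulgA lpaP_mulC // lpaP_mul_set1 //.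
by case: (_ \in _); rewrite ?numulr0.
Qed.

(** The product [s_al x]; the path enters through its action on [x] because the
    algebra has no unit to represent the empty path. *)
Definition pathS al x : L := foldr (fun e y => (lpaS R e * y)%g) x al.

Lemma pathS0 al : pathS al 0 = 0.
Proof. by elim: al => //= e al ->; rewrite numulr0. Qed.

Lemma pathSD al x y : pathS al (x + y) = pathS al x + pathS al y.
Proof. by elim: al => //= e al ->; rewrite numulDr. Qed.

Lemma pathSZ al (r : R) x : pathS al (r *: x) = r *: pathS al x.
Proof. by elim: al => //= e al ->; rewrite nuscaleAr. Qed.

Lemma pathSN al x : pathS al (- x) = - pathS al x.
Proof. by rewrite -!scaleN1r pathSZ. Qed.

Lemma pathS_mul al x y : (pathS al x * y)%g = pathS al (x * y)%g.
Proof. by elim: al => //= e al <-; rewrite mulgA. Qed.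

Lemma pathS_cat al be x : pathS (al ++ be) x = pathS al (pathS be x).
Proof. exact: foldr_cat. Qed.

Lemma lpaSstar_mul_pathS f e al x :
  (lpaSstar R f * pathS (e :: al) x)%g =
  (lpaP R (rng e) * pathS al x)%g *+ (f == e).
Proof.
by rewrite /= mulgA lpaSstar_S; case: eqP => [->|]; rewrite ?numul0r.
Qed.

Lemma lpaP_mul_pathS A e al x : gset0 A ->
  (lpaP R A * pathS (e :: al) x)%g = pathS (e :: al) x *+ (src e \in A).
Proof.
by move=> gA; rewrite /= mulgA lpaP_mulS //; case: (_ \in _); rewrite ?numul0r.
Qed.

(** Where [s_al p_A] starts: a projection onto a larger set fixes it from the
    left. *)
Definition path_src al A := if al is e :: _ then [set src e] else A.

(** Normal form for the elements [s_al p_A]: for any other pair, the element is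
    [0] or is unchanged when [A] is replaced by a smaller set. *)
Fixpoint path_into al A : Prop :=
  if al is e :: be then path_src be A `<=` rng e /\ path_into be A else True.

Lemma lpaP_mul_pathSP B al A : gset0 B -> gset0 A -> path_src al A `<=` B ->
  (lpaP R B * pathS al (lpaP R A))%g = pathS al (lpaP R A).
Proof.
case: al => [|e al] gB gA sub; first by rewrite /= lpaP_mulP // (setIidr sub).
by rewrite lpaP_mul_pathS // mem_set //; apply: sub.
Qed.

Lemma lpaP_mul_pathS_set1 B al v : gset0 B ->
  (lpaP R B * pathS al (lpaP R [set v]))%g =
  pathS al (lpaP R [set v]) *+ `[< path_src al [set v] `<=` B >].
Proof.
move=> gB; have sub1 w : `[< [set w] `<=` B >] = (w \in B).
  by apply/asboolP/idP => [sub|/set_mem Bw _ ->//]; apply/mem_set/sub.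
case: al => [|e al]; first by rewrite /= lpaP_mul_set1 // sub1.
by rewrite lpaP_mul_pathS // sub1.
Qed.

End PathElements.
#[local] Hint Resolve gset0_rng gset0_set1 : core.

(** * Reduction modulo an ideal under Condition (L) *)

Section Loops.
Local Open Scope classical_set_scope.
Variables (G : ultragraph) (R : comPzRingType).
Local Notation L := (leavitt G R).
Implicit Types (e f g : edge G) (v w : vertex G) (A B : set (vertex G)).
Implicit Types (al be ga : seq (edge G)) (x y : L).

Definition loop ga v : L := (lpaP R [set v] * pathS ga (lpaP R [set v]))%g.

Lemma pathS_neq0 e ga v : pathS (e :: ga) (lpaP R [set v]) != 0 ->
  path (fun e f => src f \in rng e) e ga /\ v \in rng (last e ga).
Proof.
elim: ga e => [|f ga IHga] e /=.
  rewrite -lpaS_P -mulgA lpaP_mul_set1 //.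
  by case: (_ \in _); rewrite // numulr0 eqxx.
move=> nz; have [|-> ->] := IHga f.
  by apply: contraNneq nz => /= ->; rewrite numulr0.
rewrite andbT; split=> //; apply: contraNT nz => /negPf ef.
rewrite mulgA -(lpaS_P R e) -(mulgA (lpaS R e)) lpaP_mulS // ef.
by rewrite numulr0 numul0r.
Qed.

Lemma loop_neq0 ga v : ga <> [::] -> loop ga v != 0 ->
  ultracycle ga /\ forall f, src (head f ga) = v.
Proof.
case: ga => // e ga _ nz.
have [|ega vga] := @pathS_neq0 e ga v.
  by apply: contraNneq nz => nz; rewrite /loop nz numulr0.
have ev : src e = v.
  apply/eqP; apply: contraNT nz => ev; rewrite /loop lpaP_mul_pathS //.
  by rewrite memNset //= => /eqP; apply/negP.
by split=> //; split=> //=; rewrite rcons_path ega ev.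
Qed.

(** Transport along the edge [f] from the corner at [src f] to the corner at a
    vertex [w] of the range of [f]. *)
Definition compress f w x : L :=
  (lpaP R [set w] * (lpaSstar R f * x * (lpaS R f * lpaP R [set w])))%g.

Lemma compress_P f w : w \in rng f ->
  compress f w (lpaP R [set src f]) = lpaP R [set w].
Proof.
move=> fw; rewrite /compress lpaSstar_P (mulgA (lpaSstar R f)) lpaSstar_S eqxx.
by rewrite lpaP_mul_set1 // fw lpaP_mul_set1 // mem_set.
Qed.

(** The factor [s_f^*] on the left removes the first edge of a closed path, or
    kills the path if it begins with another edge, and the factor [s_f] on the
    right appends the removed edge at the end. *)
Lemma compress_loop f w e ga : w \in rng f ->
  compress f w (loop (e :: ga) (src f)) = loop (rcons ga e) w *+ (f == e).
Proof.
move=> fw; rewrite /compress /loop (mulgA (lpaSstar R f)) lpaSstar_P.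
rewrite lpaSstar_mul_pathS; case: eqP => [<-|_]; last first.
  by rewrite numul0r numulr0.
rewrite -(mulgA (lpaP R (rng f))) pathS_mul mulgA (mulgA (lpaP _ [set src f])).
by rewrite lpaP_S lpaP_mulC // lpaP_mul_set1 // fw -cats1 pathS_cat.
Qed.

Lemma compressD f w : {morph compress f w : x y / x + y}.
Proof. by move=> x y; rewrite /compress numulDr numulDl numulDr. Qed.

Lemma compressZ f w (r : R) x : compress f w (r *: x) = r *: compress f w x.
Proof. by rewrite /compress -nuscaleAr -nuscaleAl -nuscaleAr. Qed.

Variable J : L -> Prop.
Hypothesis J_mull : forall x y, J y -> J (x * y)%g.
Hypothesis J_mulr : forall x y, J x -> J (x * y)%g.
Hypothesis JP : forall A (r : R), gset A -> J (r *: lpaP R A) -> r = 0.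

Definition loop_sum (r : R) (s : seq (R * seq (edge G))) v :=
  r *: lpaP R [set v] + \sum_(i <- s) i.1 *: loop i.2 v.

Definition rotations f (s : seq (R * seq (edge G))) :=
  [seq (i.1, rot 1 i.2) | i <- s & ohead i.2 == Some f].

Definition all_nonnil (s : seq (R * seq (edge G))) :=
  all (fun i => i.2 != [::]) s.

Lemma rotations_nonnil f s : all_nonnil s -> all_nonnil (rotations f s).
Proof.
move=> s_nil; rewrite /all_nonnil /rotations all_map all_filter.
apply: sub_all s_nil => -[a [|e ga]] //= _; apply/implyP => _.
by rewrite rot1_cons -size_eq0 size_rcons.
Qed.

Lemma size_rotations n f s : (size s < n)%N -> (size (rotations f s) < n)%N.
Proof.
by apply: leq_ltn_trans; rewrite size_map size_filter count_size.
Qed.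

Lemma loop_sum_rotations r s f w : w \in rng f -> all_nonnil s ->
  J (loop_sum r s (src f)) -> J (loop_sum r (rotations f s) w).
Proof.
move=> fw /allP s_nil Jx.
suff <- : compress f w (loop_sum r s (src f)) = loop_sum r (rotations f s) w.
  by apply/J_mull/J_mulr/J_mull.
rewrite /loop_sum compressD compressZ compress_P //; congr (_ + _).
rewrite (big_morph (compress f w) (compressD f w) (id1 := 0)); last first.
  by rewrite /compress numulr0 numul0r numulr0.
rewrite big_map big_filter [RHS]big_mkcond; apply: eq_big_seq => -[a ga] /s_nil.
case: ga => //= e ga _; rewrite compressZ compress_loop // rot1_cons.
by rewrite -[Some e == Some f]/(e == f) eq_sym; case: eqP; rewrite ?scaler0.
Qed.

Lemma loop_sum_sink r s w : all_nonnil s -> sink w ->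
  loop_sum r s w = r *: lpaP R [set w].
Proof.
move=> /allP s_nil w_sink; rewrite /loop_sum big1_seq ?addr0 // => -[a ga] /=.
move=> /s_nil; case: ga => //= e ga _; rewrite /loop lpaP_mul_pathS //.
by rewrite memNset ?scaler0 // => /w_sink.
Qed.

(** Induction on the number of closed paths. The first one, if it contributes at
    all, is a cycle at [v]. By Condition (L) it has an edge [f] next to an exit
    [g], or with a sink [w] in its range. Compressing along the edges in front
    of [f] rotates the cycle until [f] comes first, without creating new terms.
    In the first case a compression along [g] kills the cycle and leaves a
    shorter sum; in the second, a compression along [f] to [w] kills all closed
    paths at once, because none starts at a sink. *)
Lemma loop_sum_coef_eq0 (GL : condition_L G) r s v :
  all_nonnil s -> J (loop_sum r s v) -> r = 0.
Proof.
have [n le_s_n] := ubnP (size s).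
elim: n s v le_s_n => // n IHn [|[a ga] s] v /=.
  by move=> _ _; rewrite /loop_sum big_nil addr0; apply/JP/gset1.
rewrite ltnS => le_s_n /andP[/= /eqP ga_nil s_nil] Jx.
have [ga0|/(loop_neq0 ga_nil) [ga_cycle ga_v]] := eqVneq (loop ga v) 0.
  apply: (IHn s v) => //; move: Jx.
  by rewrite /loop_sum big_cons ga0 scaler0 add0r.
have [f fga fP] : exists2 f, f \in ga & (exists2 g, src g = src f & g <> f) \/
    exists2 w, rng f w & sink w.
  case: (GL ga ga_cycle) => [[g [f fga [gf ngf]]]|[f fga fw]]; exists f => //.
    by left; exists g.
  by right.
case: ga_cycle => _; move: ga_v Jx; case/splitPr: fga => be de {ga_nil ga}.
elim: be de s v le_s_n s_nil => [|e be IHbe] de s v le_s_n s_nil /= ga_v Jx cyc.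
  rewrite -(ga_v f) in Jx.
  have nil' : all_nonnil ((a, f :: de) :: s) by rewrite /= s_nil.
  case: fP => [[g gf ngf]|[w /mem_set fw w_sink]]; last first.
    have := loop_sum_rotations fw nil' Jx.
    rewrite (loop_sum_sink _ (rotations_nonnil f nil') w_sink).
    exact/JP/gset1.
  have [w /mem_set gw] := rng_neq0 g; rewrite -gf in Jx.
  have := loop_sum_rotations gw nil' Jx.
  rewrite /rotations /= ifN; last by apply/eqP => -[/esym].
  by apply: IHn; [apply: size_rotations|apply: rotations_nonnil].
have ew : src (head f (be ++ f :: de)) \in rng e.
  by move: cyc; case: (be) => /= [|? ?] /andP[].
rewrite -(ga_v f) /= in Jx.
have nil' : all_nonnil ((a, e :: be ++ f :: de) :: s) by rewrite /= s_nil.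
have := loop_sum_rotations ew nil' Jx.
rewrite /rotations /= eqxx /= rot1_cons rcons_cat /=.
move=> Jw; apply: (IHbe _ _ _ _ _ _ Jw);
  [exact: size_rotations|exact: rotations_nonnil| |].
  by move=> f0; case: (be).
by have := rot_cycle 1 (fun e f => src f \in rng e) (e :: be ++ f :: de);
  rewrite rot1_cons rcons_cat /= => ->.
Qed.

(** Linear independence, modulo [J], of the paths that end at [v]. The empty
    path is separated from the others by the lemma on closed paths after
    multiplying with [p_v]; a path with first edge [e] is shortened by
    multiplying with [s_e^*], where the empty path may be ignored because its
    coefficient is already known to vanish. *)
Lemma path_coef_eq0 (GL : condition_L G) (I : eqType) (s : seq I)
    (c : I -> R) (p : I -> seq (edge G)) v i :
    uniq s -> {in s &, injective p} ->
    J (\sum_(i <- s) c i *: pathS (p i) (lpaP R [set v])) ->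
  i \in s -> path_into (p i) [set v] -> c i = 0.
Proof.
have nil_case (t : seq I) (d : I -> R) (q : I -> seq (edge G)) j :
    uniq t -> {in t &, injective q} ->
    J (\sum_(i <- t) d i *: pathS (q i) (lpaP R [set v])) ->
    j \in t -> q j = [::] -> d j = 0.
  move=> Ut inj_q Jt tj qj.
  apply: (@loop_sum_coef_eq0 GL _ [seq (d i, q i) | i <- t & i != j] v).
    rewrite /all_nonnil all_map all_filter; apply/allP => i' ti' /=.
    apply/implyP; apply: contraNneq; rewrite -qj => qi'.
    by apply/eqP/inj_q.
  have := J_mull (lpaP R [set v]) Jt; rewrite (bigD1_seq j) //= qj numulDr.
  rewrite -nuscaleAr lpaP_mul_set1 // mem_set // numul_sumr.
  rewrite /loop_sum big_map big_filter; congr (J (_ + _)).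
  by apply: eq_bigr => i' _; rewrite -nuscaleAr.
move def_al: (p i) => al.
elim: al => [|e al IHal] in s c p def_al * => Us inj_p Js si.
  by move=> _; apply: nil_case Js si def_al.
move=> [sub_e al_v].
pose s' := [seq i <- s | ohead (p i) == Some e].
(* A tail whose source misses [rng e] gives [0] after the multiplication, so
   its coefficient is reset. *)
pose c' j := c j *+ `[< path_src (behead (p j)) [set v] `<=` rng e >].
have s'P j : j \in s' -> j \in s /\ p j = e :: behead (p j).
  by rewrite mem_filter; case: (p j) => [|f be] //= /andP[/eqP[->]].
have -> : c i = c' i by rewrite /c' def_al /= asboolT.
apply: (IHal s' c' (behead \o p)) => //=.
- by rewrite def_al.
- exact: filter_uniq.
- move=> j k /s'P[sj pj] /s'P[sk pk] /= e_jk; apply: inj_p => //.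
  by rewrite pj pk e_jk.
- have := J_mull (lpaSstar R e) Js; congr J; rewrite numul_sumr.
  rewrite big_filter [RHS]big_mkcond; apply: eq_big_seq => j sj.
  rewrite -nuscaleAr /c'; case def_pj: (p j) => [|f be].
    by rewrite (nil_case s c p j) ?scale0r.
  rewrite lpaSstar_mul_pathS -[_ == Some e]/(f == e) eq_sym.
  case: eqP => [<-|_] /=.
    by rewrite lpaP_mul_pathS_set1 //; case: asbool; rewrite ?scaler0 ?scale0r.
  by rewrite scaler0.
- by rewrite mem_filter def_al /= si eqxx.
Qed.

End Loops.

(** * Filtration by the length of ghost paths *)

Section GhostSpan.
Local Open Scope classical_set_scope.
Variables (G : ultragraph) (R : comPzRingType).
Local Notation L := (leavitt G R).
Implicit Types (e f g : edge G) (v w : vertex G) (A B : set (vertex G)).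
Implicit Types (al be ga : seq (edge G)) (x y : L).

Lemma path_into_sub al A B : B `<=` A -> path_into al A -> path_into al B.
Proof.
move=> BA; elim: al => //= e [|f al] IHal [sub alA]; split; try exact: IHal.
- exact: subset_trans sub.
- exact: sub.
Qed.

Lemma path_into_cat al be A : path_into be A -> path_into al (path_src be A) ->
  path_into (al ++ be) A.
Proof.
move=> beA; elim: al => //= e [|f al] IHal [sub alA]; split=> //; exact: IHal.
Qed.

(** The span of the [s_al p_A s_be^*] with [be] of length at most [n]. *)
Inductive ghost_span : nat -> L -> Prop :=
| ghost_span0 n : ghost_span n 0
| ghost_span_path n r al A : gset A -> path_into al A ->
    ghost_span n (r *: pathS al (lpaP R A))
| ghost_spanD n x y : ghost_span n x -> ghost_span n y -> ghost_span n (x + y)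
| ghost_span_Sstar n x e : ghost_span n x ->
    ghost_span n.+1 (x * lpaSstar R e)%g.

Lemma ghost_spanMn n x (b : bool) : ghost_span n x -> ghost_span n (x *+ b).
Proof. by case: b => // _; exact: ghost_span0. Qed.

Lemma ghost_span_path0 n r al A : gset0 A -> path_into al A ->
  ghost_span n (r *: pathS al (lpaP R A)).
Proof.
case=> [->|gA] alA; last exact: ghost_span_path.
by rewrite lpaP0 pathS0 scaler0; apply: ghost_span0.
Qed.

Lemma ghost_spanP n (r : R) A : gset0 A -> ghost_span n (r *: lpaP R A).
Proof. by move=> gA; apply: (@ghost_span_path0 n r [::] A). Qed.

Lemma ghost_spanW n x : ghost_span n x -> ghost_span n.+1 x.
Proof.
elim=> {n x} [n|n r al A gA alA|n x y _ IHx _ IHy|n x e _ IHx].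
- exact: ghost_span0.
- exact: ghost_span_path.
- exact: ghost_spanD.
- exact: ghost_span_Sstar.
Qed.

Lemma ghost_span_le m n x : (m <= n)%N -> ghost_span m x -> ghost_span n x.
Proof.
move=> /subnKC <-; elim: (n - m)%N => [|k IHk]; first by rewrite addn0.
by rewrite addnS => /IHk; apply: ghost_spanW.
Qed.

Lemma ghost_spanZ n (r : R) x : ghost_span n x -> ghost_span n (r *: x).
Proof.
elim=> {n x} [n|n a al A gA alA|n x y _ IHx _ IHy|n x e _ IHx].
- by rewrite scaler0; apply: ghost_span0.
- by rewrite scalerA; apply: ghost_span_path.
- by rewrite scalerDr; apply: ghost_spanD.
- by rewrite nuscaleAl; apply: ghost_span_Sstar.
Qed.

Lemma ghost_span_mulPl n B x : gset0 B -> ghost_span n x ->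
  ghost_span n (lpaP R B * x)%g.
Proof.
move=> gB; elim=> {n x} [n|n r al A gA alA|n x y _ IHx _ IHy|n x e _ IHx].
- by rewrite numulr0; apply: ghost_span0.
- rewrite -nuscaleAr; case: al alA => [|e al] alA.
    rewrite /= lpaP_mulP //; last by right.
    by apply: ghost_spanP; apply: gset0I => //; right.
  by rewrite lpaP_mul_pathS // -scalerMnr; apply/ghost_spanMn/ghost_span_path.
- by rewrite numulDr; apply: ghost_spanD.
- by rewrite mulgA; apply: ghost_span_Sstar.
Qed.

Lemma ghost_span_mulSl n f x : ghost_span n x -> ghost_span n (lpaS R f * x)%g.
Proof.
elim=> {n x} [n|n r al A gA alA|n x y _ IHx _ IHy|n x e _ IHx].
- by rewrite numulr0; apply: ghost_span0.
- rewrite -nuscaleAr -lpaS_P -mulgA; case: al alA => [|e al] alA.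
    rewrite /= lpaP_mulP //; last by right.
    rewrite -[(lpaS R f * _)%g]/(pathS [:: f] _).
    apply: ghost_span_path0; first by apply: gset0I => //; right.
    by split=> //; apply: subIsetl.
  rewrite lpaP_mul_pathS //; case: (boolP (_ \in _)) => [/set_mem ef|_].
    rewrite mulr1n -[(lpaS R f * _)%g]/(pathS [:: f, e & al] _).
    by apply: ghost_span_path => //; split=> // _ ->.
  by rewrite numulr0 scaler0; apply: ghost_span0.
- by rewrite numulDr; apply: ghost_spanD.
- by rewrite mulgA; apply: ghost_span_Sstar.
Qed.

Lemma ghost_span_mulSstarl n f x : ghost_span n x ->
  ghost_span n.+1 (lpaSstar R f * x)%g.
Proof.
elim=> {n x} [n|n r al A gA alA|n x y _ IHx _ IHy|n x e _ IHx].
- by rewrite numulr0; apply: ghost_span0.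
- rewrite -nuscaleAr; case: al alA => [|e al] alA.
    rewrite /= lpaSstar_mulP; last by right.
    rewrite -scalerMnr -lpaP_Sstar nuscaleAl.
    exact/ghost_spanMn/ghost_span_Sstar/ghost_spanP.
  case: alA => sub alA; rewrite lpaSstar_mul_pathS -scalerMnr.
  rewrite lpaP_mul_pathSP //; last by right.
  exact/ghost_spanMn/ghost_span_path.
- by rewrite numulDr; apply: ghost_spanD.
- by rewrite mulgA; apply: ghost_span_Sstar.
Qed.

Lemma ghost_span_mulPr n B x : gset0 B -> ghost_span n x ->
  ghost_span n (x * lpaP R B)%g.
Proof.
move=> gB; elim=> {n x} [n|n r al A gA alA|n x y _ IHx _ IHy|n x e nx _].
- by rewrite numul0r; apply: ghost_span0.
- rewrite -nuscaleAl pathS_mul lpaP_mulP //; last by right.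
  apply: ghost_span_path0; first by apply: gset0I => //; right.
  by apply: path_into_sub alA; apply: subIsetl.
- by rewrite numulDl; apply: ghost_spanD.
- rewrite -mulgA lpaSstar_mulP //; case: (_ \in _).
    exact: ghost_span_Sstar.
  by rewrite numulr0; apply: ghost_span0.
Qed.

(** Right multiplication by [s_e] shortens the ghost paths, by
    [s_f^* s_e = p_{r(e)}] or [0]; ghost-free terms stay ghost-free. *)
Lemma ghost_span_mulSr n x e : ghost_span n x ->
  ghost_span n.-1 (x * lpaS R e)%g.
Proof.
elim=> {n x} [n|n r al A gA alA|n x y _ IHx _ IHy|n x f nx _].
- by rewrite numul0r; apply: ghost_span0.
- rewrite -nuscaleAl pathS_mul lpaP_mulS; last by right.
  case: (boolP (_ \in _)) => [/set_mem Ae|_]; last first.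
    by rewrite pathS0 scaler0; apply: ghost_span0.
  rewrite -lpaS_P -[(lpaS R e * _)%g]/(pathS [:: e] _) -pathS_cat.
  apply: ghost_span_path; first exact: gset_rng.
  apply: path_into_cat; first by split.
  by apply: path_into_sub alA => _ ->.
- by rewrite numulDl; apply: ghost_spanD.
- rewrite -mulgA lpaSstar_S; case: ifP => _; first exact: ghost_span_mulPr.
  by rewrite numulr0; apply: ghost_span0.
Qed.

(** Left multiplication by each generator preserves the filtration up to one
    step, hence so does left multiplication by any algebraic expression; the
    statement about products is carried along the induction on expressions. *)
Lemma ghost_span_exhaustive x : exists n, ghost_span n x.
Proof.
elim/presalg_classW: x => t.
suff [] : (exists n, ghost_span n (presalg_class _ t)) /\
    forall n x, ghost_span n x ->
      exists m, ghost_span m (presalg_class _ t * x)%g.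
  by [].
have addP x y : (exists n, ghost_span n x) -> (exists n, ghost_span n y) ->
    exists n, ghost_span n (x + y).
  move=> [m mx] [n ny]; exists (maxn m n); apply: ghost_spanD.
    exact: ghost_span_le (leq_maxl m n) mx.
  exact: ghost_span_le (leq_maxr m n) ny.
have ZP (r : R) x : (exists n, ghost_span n x) ->
    exists n, ghost_span n (r *: x).
  by move=> [n nx]; exists n; apply: ghost_spanZ.
elim: t => [[A gA|e|e]||t [IHt IHtM] u [IHu IHuM]|t [IHt IHtM]|a t [IHt IHtM]
  |t [IHt IHtM] u [IHu IHuM]].
- have -> : presalg_class (@lpa_rel G R) (TGen (GenP gA)) = lpaP R A.
    rewrite /lpaP /termP; case: pselect => // gA'.
    by rewrite (Prop_irrelevance gA gA').
  split=> [|n x nx]; last by exists n; apply: ghost_span_mulPl => //; right.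
  by exists 0; rewrite -[lpaP R A]scale1r; apply: ghost_spanP; right.
- split=> [|n x nx]; last by exists n; apply: ghost_span_mulSl.
  rewrite -[presalg_class _ _]/(lpaS R e) -lpaS_P; exists 0.
  by rewrite -[lpaP R _]scale1r; apply/ghost_span_mulSl/ghost_spanP.
- split=> [|n x nx]; last by exists n.+1; apply: ghost_span_mulSstarl.
  rewrite -[presalg_class _ _]/(lpaSstar R e) -lpaSstar_P; exists 1.
  by rewrite -[lpaP R _]scale1r; apply/ghost_span_mulSstarl/ghost_spanP.
- split=> [|n x _]; exists 0; last rewrite numul0r; exact: ghost_span0.
- rewrite presalg_classD; split=> [|n x nx]; first exact: addP.
  by rewrite numulDl; apply: addP; [apply: IHtM nx|apply: IHuM nx].
- rewrite presalg_classN -scaleN1r; split=> [|n x nx]; first exact: ZP.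
  by rewrite -nuscaleAl; apply/ZP/(IHtM n).
- rewrite presalg_classZ; split=> [|n x nx]; first exact: ZP.
  by rewrite -nuscaleAl; apply/ZP/(IHtM n).
- rewrite presalg_classM; split=> [|n x nx].
    by have [n nu] := IHu; apply: IHtM nu.
  by rewrite -mulgA; have [m mx] := IHuM n x nx; apply: IHtM mx.
Qed.

End GhostSpan.

(** * Ideals that avoid the projections *)

Lemma big_fibers (V : nmodType) (I K : eqType) (h : I -> K) (s : seq I)
    (F : I -> V) :
  \sum_(i <- s) F i =
  \sum_(k <- undup (map h s)) \sum_(i <- s | h i == k) F i.
Proof.
under [RHS]eq_bigr do rewrite big_mkcond /=.
rewrite exchange_big /=; apply: eq_big_seq => i si.
rewrite (bigD1_seq (h i)) ?undup_uniq ?mem_undup ?map_f //= eqxx big1 ?addr0 //.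
by move=> k; rewrite eq_sym => /negPf ->.
Qed.

Section Uniqueness.
Local Open Scope classical_set_scope.
Variables (G : ultragraph) (R : comPzRingType).
Local Notation L := (leavitt G R).
Implicit Types (e f g : edge G) (v w : vertex G) (A B : set (vertex G)).
Implicit Types (al be ga : seq (edge G)) (x y : L) (E : seq (edge G)).
Implicit Types (s : seq (R * seq (edge G) * set (vertex G))).

(** In a unitization this is [x (1 - \sum_(e <- E) s_e s_e^* )]. *)
Definition cut E x : L := x - \sum_(e <- E) (x * (lpaS R e * lpaSstar R e))%g.

Lemma cutD E : {morph cut E : x y / x + y}.
Proof.
move=> x y; rewrite /cut addrACA -opprD -big_split; congr (_ - _).
by apply: eq_bigr => e _; rewrite numulDl.
Qed.

Lemma cutZ E (r : R) x : cut E (r *: x) = r *: cut E x.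
Proof.
rewrite /cut scalerBr scaler_sumr; congr (_ - _).
by apply: eq_bigr => e _; rewrite nuscaleAl.
Qed.

Lemma cut0 E : cut E 0 = 0.
Proof. by apply: (addrI (cut E 0)); rewrite -cutD !addr0. Qed.

Lemma cutB E x y : cut E (x - y) = cut E x - cut E y.
Proof. by rewrite cutD -scaleN1r cutZ scaleN1r. Qed.

Lemma cut_pathS E al x : cut E (pathS al x) = pathS al (cut E x).
Proof.
rewrite /cut pathSD pathSN; congr (_ - _).
rewrite [RHS](big_morph _ (pathSD al) (pathS0 _ al)).
by apply: eq_bigr => e _; rewrite pathS_mul.
Qed.

Lemma cut_Sstar E x e : uniq E -> e \in E -> cut E (x * lpaSstar R e)%g = 0.
Proof.
move=> UE Ee; rewrite /cut (bigD1_seq e) //= big1 ?addr0.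
  by rewrite -mulgA (mulgA (lpaSstar R e)) lpaSstar_S eqxx lpaP_Sstar subrr.
move=> f /negPf fe; rewrite -mulgA (mulgA (lpaSstar R e)) lpaSstar_S eq_sym fe.
by rewrite numul0r numulr0.
Qed.

Lemma cut_CuntzKrieger E e : uniq E -> (forall f, src f = src e -> f \in E) ->
  cut E (lpaP R [set src e]) = 0.
Proof.
move=> UE allE; rewrite /cut.
rewrite {1}(@lpa_CuntzKrieger _ _ (src e) [seq f <- E | src f == src e]).
- rewrite big_filter big_mkcond -sumrB big1 // => f _.
  rewrite mulgA lpaP_mulS //; case: eqP => [fe|fe].
    by rewrite mem_set // subrr.
  by rewrite memNset // numul0r subrr.
- move=> /eqP; apply/negP; rewrite -has_filter; apply/hasP; exists e => //.
  exact: allE.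
- exact: filter_uniq.
- move=> f; rewrite mem_filter; split=> [/andP[/eqP]//|fe].
  by rewrite fe eqxx allE.
Qed.

Definition ghost_free s : L :=
  \sum_(m <- s) m.1.1 *: pathS m.1.2 (lpaP R m.2).

Definition ghost_free_wf s :=
  forall m, m \in s -> gset m.2 /\ path_into m.1.2 m.2.

(** Every element is a ghost-free one up to terms ending in some [s_e^*], which
    [cut] kills as soon as [e] belongs to the list. The list [E] may be
    enlarged so that the lists of two summands can be merged. *)
Lemma ghost_span_decomp n x : ghost_span n x ->
  exists s E, [/\ ghost_free_wf s, uniq E, (n = 0%N -> E = [::]) &
    forall E', uniq E' -> {subset E <= E'} -> cut E' (x - ghost_free s) = 0].
Proof.
elim=> {n x} [n|n r al A gA alA|n x y _ [s1 [E1 [s1P UE1 E1n xs1]]]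
  _ [s2 [E2 [s2P UE2 E2n ys2]]]|n x e _ _].
- exists [::], [::]; split=> // E _ _.
  by rewrite /ghost_free big_nil subrr cut0.
- exists [:: (r, al, A)], [::]; split=> // [m|E _ _].
    by rewrite inE => /eqP ->.
  by rewrite /ghost_free big_seq1 subrr cut0.
- exists (s1 ++ s2), (undup (E1 ++ E2)); split=> [m| |n0|E UE subE].
  + by rewrite mem_cat => /orP[/s1P|/s2P].
  + exact: undup_uniq.
  + by rewrite E1n // E2n.
  + rewrite /ghost_free big_cat opprD addrACA cutD xs1 ?ys2 ?addr0 // => e eE;
      by apply: subE; rewrite mem_undup mem_cat eE ?orbT.
- exists [::], [:: e]; split=> // E UE subE.
  rewrite /ghost_free big_nil subr0 cut_Sstar //.
  by apply: subE; rewrite inE.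
Qed.

Lemma cut_eq0_mulS E x e : cut E x = 0 -> e \notin E -> (x * lpaS R e)%g = 0.
Proof.
move=> /eqP; rewrite subr_eq0 => /eqP -> eE.
rewrite numul_suml big1_seq // => f /= fE.
rewrite -!mulgA lpaSstar_S; case: eqP => [fe|_]; last by rewrite !numulr0.
by rewrite -fe fE in eE.
Qed.

Lemma cut_eq0_mul_set1 E x v :
    cut E x = 0 -> (forall e, e \in E -> src e <> v) ->
  (x * lpaP R [set v])%g = 0.
Proof.
move=> /eqP; rewrite subr_eq0 => /eqP -> Ev.
rewrite numul_suml big1_seq // => f /= /Ev fv.
by rewrite -!mulgA lpaSstar_mulP // memNset // !numulr0.
Qed.

(** Multiplying by a path that starts at [v] evaluates the coefficients at [v]:
    the coefficient of [al] is the value at [v] of the simple function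
    [\sum r_i 1_{A_i}] over the terms [r_i s_al p_{A_i}]. *)
Lemma ghost_free_mul_pathS s be w v : ghost_free_wf s ->
    path_src be [set w] = [set v] ->
  (ghost_free s * pathS be (lpaP R [set w]))%g =
  \sum_(al <- undup [seq m.1.2 | m <- s])
    (\sum_(m <- s | m.1.2 == al) m.1.1 *+ (v \in m.2)) *:
      pathS (al ++ be) (lpaP R [set w]).
Proof.
move=> sP be_v; rewrite /ghost_free numul_suml.
under [RHS]eq_bigr do rewrite scaler_suml.
transitivity (\sum_(m <- s) (m.1.1 *+ (v \in m.2)) *:
    pathS (m.1.2 ++ be) (lpaP R [set w])); last first.
  rewrite (big_fibers (fun m => m.1.2)); apply: eq_bigr => al _.
  by apply: eq_bigr => m /eqP ->.
apply: eq_big_seq => -[[r al] A] /sP[/= gA _].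
rewrite -nuscaleAl pathS_mul lpaP_mul_pathS_set1; last by right.
rewrite pathS_cat be_v; have [Av|Av] := boolP (v \in A).
  by rewrite asboolT // => _ ->; apply/set_mem.
rewrite asboolF ?pathS0 ?scaler0 ?scale0r // => sub.
by move: Av; rewrite mem_set //; apply: sub.
Qed.

Variable J : L -> Prop.
Hypothesis J_mull : forall x y, J y -> J (x * y)%g.
Hypothesis J_mulr : forall x y, J x -> J (x * y)%g.
Hypothesis JP : forall A (r : R), gset A -> J (r *: lpaP R A) -> r = 0.

(** If no term with the path [al] has [v] in its set, the sum has only zero
    terms; otherwise [al ++ be] is a path to [w], and paths to [w] are
    independent. *)
Lemma ghost_free_coef_eq0 (GL : condition_L G) s be w v al :
    ghost_free_wf s -> path_into be [set w] -> path_src be [set w] = [set v] ->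
    J (ghost_free s * pathS be (lpaP R [set w]))%g ->
  \sum_(m <- s | m.1.2 == al) m.1.1 *+ (v \in m.2) = 0.
Proof.
move=> sP be_w be_v; rewrite (ghost_free_mul_pathS sP be_v) => Js.
have [[m sm /andP[/eqP mal mv]]|none] :=
    pselect (exists2 m, m \in s & (m.1.2 == al) && (v \in m.2)); last first.
  rewrite big1_seq // => m /andP[/eqP mal sm].
  case: (boolP (v \in m.2)) => // mv; case: none; exists m => //.
  by rewrite mal eqxx.
apply: (path_coef_eq0 J_mull J_mulr JP GL (i := al)
  (c := fun al => \sum_(m <- s | m.1.2 == al) m.1.1 *+ (v \in m.2)) _ _ Js).
- exact: undup_uniq.
- move=> al1 al2 _ _ e12.
  have /addIn s12 : (size al1 + size be = size al2 + size be)%N.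
    by rewrite -!size_cat e12.
  by move/eqP: e12; rewrite eqseq_cat // => /andP[/eqP].
- by rewrite mem_undup -mal (map_f (fun m => m.1.2)).
- apply: path_into_cat => //; rewrite be_v -mal.
  by have [_] := sP m sm; apply: path_into_sub => _ ->; apply/set_mem.
Qed.

(** Induction on [n]: for [e] in [E] the element [x s_e] is [0] by induction,
    and [E] is empty if [n = 0], so [x = cut E x = cut E y] with [y] ghost-free.
    For a fixed path [al], the map [A |-> cut E (s_al p_A)] is modular, and a
    vertex [v] is of one of three kinds. If [v] emits an edge [e] outside [E],
    then [y s_e = x s_e] lies in [J] and the coefficients of [y] at [v] vanish.
    If [v] is a sink, the same follows from [y p_v = x p_v]. Otherwise all the
    edges out of [v] are in [E], and the Cuntz--Krieger relation makes [v] a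
    null point; there are finitely many of these. *)
Lemma ghost_span_ideal_eq0 (GL : condition_L G) n x :
  ghost_span n x -> J x -> x = 0.
Proof.
have [k le_n_k] := ubnP n; elim: k => // k IHk in n x le_n_k * => nx Jx.
have [s [E [sP UE En /(_ E UE) xs]]] := ghost_span_decomp nx.
have {}xs : cut E (x - ghost_free s) = 0 by apply: xs.
have xE e : e \in E -> (x * lpaS R e)%g = 0.
  case: n => [|n] in le_n_k nx En *; first by rewrite En.
  by move=> _; apply: (IHk n) => //; [apply: ghost_span_mulSr nx|apply: J_mulr].
have cut_x : cut E x = x.
  by rewrite /cut big1_seq ?subr0 // => e /= /xE xe; rewrite mulgA xe numul0r.
have -> : x = cut E (ghost_free s).
  by rewrite -cut_x; apply/eqP; rewrite -subr_eq0 -cutB xs.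
pose N := [seq src e | e <- E & `[< cut E (lpaP R [set src e]) = 0 >]].
have coef0 v al : v \notin N ->
    \sum_(m <- s | m.1.2 == al) m.1.1 *+ (v \in m.2) = 0.
  move=> Nv; have [[e ev Ee]|allE] :=
      pselect (exists2 e, src e = v & e \notin E).
    have [w ew] := rng_neq0 e.
    apply: (ghost_free_coef_eq0 GL (be := [:: e]) (w := w)) => //.
    - by split=> // _ ->.
    - by rewrite /= ev.
    rewrite /= mulgA; apply: J_mulr.
    suff <- : (x * lpaS R e)%g = (ghost_free s * lpaS R e)%g by apply: J_mulr.
    by apply/eqP; rewrite -subr_eq0 -numulBl (cut_eq0_mulS xs).
  have {}allE f : src f = v -> f \in E.
    by move=> fv; apply: contrapT => /negP fE; apply: allE; exists f.
  apply: (ghost_free_coef_eq0 GL (be := [::]) (w := v)) => //.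
  suff <- : (x * lpaP R [set v])%g = (ghost_free s * lpaP R [set v])%g.
    exact: J_mulr.
  apply/eqP; rewrite -subr_eq0 -numulBl (cut_eq0_mul_set1 xs) // => e eE ev.
  move/negP: Nv; apply; rewrite -ev; apply/mapP; exists e => //.
  rewrite mem_filter eE andbT; apply/asboolP/cut_CuntzKrieger => // f.
  by rewrite ev; apply: allE.
rewrite /ghost_free (big_morph _ (cutD E) (cut0 E)).
rewrite (big_fibers (fun m => m.1.2)) big1 // => al _.
transitivity (\sum_(i <- [seq (m.1.1, m.2) | m <- s & m.1.2 == al])
    i.1 *: cut E (pathS al (lpaP R i.2))).
  rewrite big_map big_filter; apply: eq_bigr => m /eqP <-; exact: cutZ.
apply: (modular_sum_eq0 (lat := @gset0 G)
  (F := fun A => cut E (pathS al (lpaP R A))) _ _ _ _ _ (N := N)).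
- by left.
- exact: gset0U.
- exact: gset0I.
- by rewrite lpaP0 pathS0 cut0.
- move=> A B gA gB; rewrite lpaP_modular // !pathSD pathSN.
  by rewrite cutB cutD.
- move=> i /mapP[m]; rewrite mem_filter => /andP[_ /sP[gm _]] -> /=; by right.
- move=> v /mapP[e]; rewrite mem_filter => /andP[/asboolP e0 _] ->.
  by split=> //; rewrite cut_pathS e0 pathS0.
- by move=> v Nv; rewrite big_map big_filter; apply: coef0.
Qed.

End Uniqueness.

Theorem corollary4p3 (G : ultragraph) (R : comPzRingType) (S : nuRingType)
    (phi : {nurmorphism leavitt G R -> S})
    (GL : condition_L G)
    (phi_p : forall (A : set (vertex G)) (r : R),
       gset A -> r <> 0 -> phi (r *: lpaP R A) <> 0) :
  injective phi.
Proof.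
move=> x y phi_xy; apply/eqP; rewrite -subr_eq0; apply/eqP.
have [n nxy] := ghost_span_exhaustive (x - y).
apply: (ghost_span_ideal_eq0 (J := fun z => phi z = 0) _ _ _ GL nxy).
- by move=> z t /= pt; transitivity (phi z * phi t)%g;
    [exact: gmulfM|rewrite pt numulr0].
- by move=> z t /= pz; transitivity (phi z * phi t)%g;
    [exact: gmulfM|rewrite pz numul0r].
- by move=> A r gA prA; apply: contrapT => r0; apply: (phi_p A r).
- by rewrite /= raddfB; apply/eqP; rewrite subr_eq0; apply/eqP.
Qed.
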